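(* Let $n\in\mathbb{N}$, let $a$ be any real number with $a>n-1$, and let $0<p<1$. Then the zeros of the polynomial $K_n(x;p,a)$ (in the variable $x$) lie in the open interval $(0,a)$.
   Context: $\mathbb{N}=\{1,2,3,\dots\}$. The Pochhammer symbol is $(\alpha)_0=1$ and $(\alpha)_m=\alpha(\alpha+1)\cdots(\alpha+m-1)$ for $m\ge 1$. For $n\in\{0,1,2,\dots\}$, $a\in\mathbb{R}$ and real $p\neq 0$, the (generalized) Krawtchouk polynomial is the polynomial of degree $n$ in $x$ given by $$K_n(x;p,a)=\sum_{k=0}^n\frac{(-n)_k(-x)_k(-a+k)_{n-k}}{k!\,p^k}.$$ Zeros means all (complex) zeros. *)

(* Defs.v *)
From mathcomp Require Import all_boot all_order all_algebra.

Set Implicit Arguments.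
Unset Strict Implicit.
Unset Printing Implicit Defensive.

Import GRing.Theory.
Local Open Scope ring_scope.

(* Generic in the ring, because krawtchouk applies it both to scalars and to
   the polynomial - 'X. *)
Definition pochhammer (A : comNzRingType) (x : A) (m : nat) : A :=
  \prod_(i < m) (x + i%:R).

(* K_n(x; p, a) as a polynomial in x: the factor (-x)_k is the polynomial
   pochhammer (- 'X) k, everything else is its scalar coefficient. *)
Definition krawtchouk (F : fieldType) (n : nat) (p a : F) : {poly F} :=
  \sum_(0 <= k < n.+1)
    (pochhammer (- n%:R) k * pochhammer (- a + k%:R) (n - k)
       / (k`!%:R * p ^+ k)) *: pochhammer (- 'X) k.

(* Main.v *)
Require Import Defs.
From mathcomp Require Import all_boot all_order all_algebra.
From mathcomp Require Import reals complex.
From mathcomp Require Import ring lra zify.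

Set Implicit Arguments.
Unset Strict Implicit.
Unset Printing Implicit Defensive.

Import Order.TTheory GRing.Theory Num.Theory.
Local Open Scope ring_scope.
Local Open Scope complex_scope.

(** The idea is to follow the ratios [r_m = K_{m+1} / K_m] of consecutive
    polynomials. They obey a three-term recurrence ([krawtchouk_rec])
      [p K_{m+2} = (x - b_m) K_{m+1} - c_m K_m],  [c_m = (m+1) (1-p) (a-m)],
    so that [r_{m+1} = (x - b_m) / p - (c_m / p) / r_m]. Since [a > n - 1],
    each [c_m] used to reach [K_n] is positive, and a map
    [r |-> t - c / r] with [c > 0] is increasing on each half-line and preserves
    both open half-planes for real [t]. Hence, by induction on [m]:
    - if [x] is not real, [Im r_m] has the sign of [Im x];
    - if [x <= 0], then [r_m <= r_m(0) = m - a < 0];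
    - if [x >= a], then [r_m >= r_m(a) = (a - m) (1 - p) / p > 0].
    In each case no ratio vanishes, so [K_n] does not vanish at [x]; what
    remains for the zeros is the open interval between [0] and [a].
    The first case is [krawtchouk_neq0_nonreal], the other two are
    [krawtchouk_neq0_left] and [krawtchouk_neq0_right]; the induction that they
    share is [ratio_invariant_neq0].

    The recurrence itself is a comparison of coefficients in the basis
    [(-x)_k], on which multiplication by [x] acts by
    [x (-x)_k = k (-x)_k - (-x)_{k+1}]. *)

(** * The three-term recurrence *)

Lemma pochhammer0 (A : comNzRingType) (x : A) : pochhammer x 0 = 1.
Proof. by rewrite /pochhammer big_ord0. Qed.

Lemma pochhammerSr (A : comNzRingType) (x : A) m :
  pochhammer x m.+1 = pochhammer x m * (x + m%:R).
Proof. by rewrite /pochhammer big_ord_recr. Qed.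

Lemma pochhammerSl (A : comNzRingType) (x : A) m :
  pochhammer x m.+1 = x * pochhammer (x + 1) m.
Proof.
rewrite /pochhammer big_ord_recl addr0; congr (_ * _).
by apply: eq_bigr => i _; rewrite -addrA nat1r.
Qed.

Lemma pochhammer_oppn_eq0 (A : comNzRingType) n m :
  (n < m)%N -> pochhammer (- n%:R : A) m = 0.
Proof.
by move=> nm; rewrite /pochhammer (bigD1 (Ordinal nm)) //= addNr mul0r.
Qed.

Definition krawtchouk_coef (F : fieldType) (p a : F) (n k : nat) : F :=
  pochhammer (- n%:R) k * pochhammer (- a + k%:R) (n - k)
    / (k`!%:R * p ^+ k).

(** The factor [(-n)_k] vanishes for [n < k], so sums for several degrees can be
    brought to one common range. *)
Lemma krawtchouk_widen (F : fieldType) (p a : F) n N : (n < N)%N ->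
  krawtchouk n p a =
    \sum_(0 <= k < N) krawtchouk_coef p a n k *: pochhammer (- 'X) k.
Proof.
move=> nN; rewrite (@big_cat_nat _ _ _ n.+1) //=.
rewrite [X in _ + X]big_nat_cond [X in _ + X]big1 ?addr0 // => k.
rewrite andbT => /andP[nk _].
by rewrite /krawtchouk_coef pochhammer_oppn_eq0 // !mul0r scale0r.
Qed.

(** For [k = j + 1] all the coefficients involved share the factor [(-n-1)_j]
    and, when [j < n], the factor [(-a+j+1)_{n-j-1}]; once these are taken out, an
    identity between rational functions remains. The values [j = n] and
    [j = n + 1] are computed apart because subtraction truncates there. *)
Lemma krawtchouk_coef_rec (F : numFieldType) (p a : F) n k :
  p != 0 -> (k <= n.+2)%N ->
  p * krawtchouk_coef p a n.+2 k =
    (k%:R - (p * (a - n.+1%:R) + n.+1%:R * (1 - p)))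
      * krawtchouk_coef p a n.+1 k
    - (if k is j.+1 then krawtchouk_coef p a n.+1 j else 0)
    - n.+1%:R * (1 - p) * (a - n%:R) * krawtchouk_coef p a n k.
Proof.
move=> p0; case: k => [_|k].
  rewrite /krawtchouk_coef !subn0 !pochhammer0 !pochhammerSr !addr0.
  by rewrite fact0 expr0 -!natr1; field.
have n1 : (n%:R + 1 : F) != 0 by rewrite natr1 pnatr_eq0.
have k1 : (k%:R + 1 : F) != 0 by rewrite natr1 pnatr_eq0.
have kf : (k`!%:R : F) != 0 by rewrite pnatr_eq0 -lt0n fact_gt0.
rewrite /krawtchouk_coef !factS !natrM !exprS => kn.
have E2 : pochhammer (- n.+2%:R : F) k.+1 =
    (- n%:R - 2) * pochhammer (- n.+1%:R) k.
  rewrite pochhammerSl -!natr1; congr (_ * pochhammer _ k); ring.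
have E1 : pochhammer (- n.+1%:R : F) k.+1 =
    pochhammer (- n.+1%:R) k * (- n%:R - 1 + k%:R).
  by rewrite pochhammerSr -!natr1; ring.
have E0 : pochhammer (- n%:R : F) k.+1 =
    - (pochhammer (- n.+1%:R) k * (- n%:R - 1 + k%:R) * (- n%:R + k%:R))
      / (n%:R + 1).
  apply: (mulIf n1); rewrite mulfVK //.
  transitivity (- pochhammer (- n.+1%:R : F) k.+2).
    rewrite [in RHS]pochhammerSl.
    have -> : - n.+1%:R + 1 = - n%:R :> F by rewrite -natr1; ring.
    by rewrite -natr1; ring.
  by rewrite !pochhammerSr -!natr1; ring.
rewrite E2 E1 E0.
have [nk|kn1] := leqP n k.
  have {kn nk} [?|?] : k = n \/ k = n.+1 by lia.
    have [-> -> -> ->] : [/\ n - k.+1 = 0, n.+1 - k.+1 = 0, n.+2 - k.+1 = 1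
      & n.+1 - k = 1]%N by split; lia.
    subst k; rewrite pochhammer0 !pochhammerSr !pochhammer0 -!natr1; field.
    by rewrite ?expf_neq0 ?p0 ?n1 ?kf.
  have [-> -> -> ->] : [/\ n - k.+1 = 0, n.+1 - k.+1 = 0, n.+2 - k.+1 = 0
    & n.+1 - k = 0]%N by split; lia.
  subst k; rewrite !pochhammer0 -!natr1 in k1 *; field.
  by rewrite ?expf_neq0 ?p0 ?n1 ?k1 ?kf.
(* From here on k < n, and every length is d plus a constant. *)
have [d En] : exists d, n = (k + d).+1 by exists (n - k.+1)%N; lia.
have [-> -> -> ->] : [/\ n - k.+1 = d, n.+1 - k.+1 = d.+1,
  n.+2 - k.+1 = d.+2 & n.+1 - k = d.+2]%N by split; lia.
rewrite [pochhammer (_ + k%:R) _]pochhammerSl -[- a + k%:R + 1]addrA natr1.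
rewrite !pochhammerSr.
have En' : n%:R = k%:R + d%:R + 1 :> F by rewrite En -natr1 natrD.
rewrite -!natr1 En' in n1 *; field.
by rewrite ?p0 ?n1 ?k1 ?kf ?expf_neq0.
Qed.

Lemma krawtchouk_rec (F : numFieldType) (p a : F) n : p != 0 ->
  p *: krawtchouk n.+2 p a =
    ('X - (p * (a - n.+1%:R) + n.+1%:R * (1 - p))%:P) * krawtchouk n.+1 p a
    - (n.+1%:R * (1 - p) * (a - n%:R)) *: krawtchouk n p a.
Proof.
move=> p0; set b := p * _ + _; set d := _ * (a - n%:R).
have XP k : 'X * pochhammer (- 'X) k =
    k%:R *: pochhammer (- 'X) k - pochhammer (- 'X) k.+1 :> {poly F}.
  by rewrite pochhammerSr scaler_nat -mulr_natr; ring.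
(* The shift k -> k + 1 brings in the preceding coefficient. *)
have XK : 'X * krawtchouk n.+1 p a = \sum_(0 <= k < n.+3)
    (k%:R * krawtchouk_coef p a n.+1 k
     - (if k is j.+1 then krawtchouk_coef p a n.+1 j else 0))
       *: pochhammer (- 'X) k.
  under eq_bigr do rewrite scalerBl; rewrite sumrB.
  rewrite [X in _ - X]big_nat_recl //= scale0r add0r.
  rewrite [X in X - _]big_nat_recr //=.
  rewrite {2}/krawtchouk_coef pochhammer_oppn_eq0 // !(mul0r, mulr0).
  rewrite scale0r addr0.
  rewrite /krawtchouk mulr_sumr -sumrB; apply: eq_bigr => k _.
  rewrite -scalerAr XP scalerBr scalerA; congr (_ *: _ - _ *: _).
  exact: mulrC.
rewrite mulrBl XK mul_polyC (@krawtchouk_widen _ p a n.+1 n.+3) //.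
rewrite !(@krawtchouk_widen _ p a _ n.+3) ?ltnS ?leqW // !scaler_sumr -!sumrB.
apply: eq_big_nat => k /andP[_ kn].
rewrite !scalerA -!scalerBl krawtchouk_coef_rec //; congr (_ *: _).
rewrite -/b -/d; ring.
Qed.

Lemma krawtchouk0 (F : fieldType) (p a : F) : krawtchouk 0 p a = 1.
Proof.
by rewrite /krawtchouk big_nat1 !pochhammer0 fact0 expr0 !mulr1 divr1 scale1r.
Qed.

Lemma krawtchouk1 (F : fieldType) (p a : F) : p != 0 ->
  p *: krawtchouk 1 p a = 'X - (p * a)%:P.
Proof.
move=> p0; rewrite /krawtchouk big_nat_recr // big_nat1 /=.
rewrite !pochhammerSr !pochhammer0 !fact0 factS fact0 !addr0 !expr0 expr1.
rewrite scalerDr !scalerA !mul1r !mulr1 !divr1 mulrCA mulfV // mulr1.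
by rewrite scaleN1r opprK alg_polyC mulrN polyCN addrC.
Qed.

(** * Invariants of the ratios *)

(** [S m] is a region avoiding [0] in which the ratio [u m.+1 / u m] is trapped.
    The nonvanishing of [u m] and the membership of the ratio in [S m] have to be
    proved together, as each makes the next instance of the other meaningful. *)
Lemma ratio_invariant_neq0 (F : fieldType) (u g d : nat -> F)
    (S : nat -> F -> Prop) (N : nat) :
  (forall m, ~ S m 0) -> u 0%N = 1 -> S 0%N (u 1%N) ->
  (forall m, (m < N)%N -> u m.+2 = g m * u m.+1 - d m * u m) ->
  (forall m r, (m < N)%N -> S m r -> S m.+1 (g m - d m / r)) ->
  forall m, (m <= N)%N -> u m.+1 != 0.
Proof.
move=> S0 u0 Su1 urec Sstep.
suff H m : (m <= N)%N -> u m != 0 /\ S m (u m.+1 / u m).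
  move=> m /H[um]; case: eqP => // ->; rewrite mul0r => /S0 //.
elim: m => [_|m IH mN]; first by rewrite u0 oner_eq0 divr1.
have [um Sm] := IH (ltnW mN).
have um1 : u m.+1 != 0.
  by case: eqP Sm => // ->; rewrite mul0r => /S0.
split=> //; move: (Sstep _ _ mN Sm); congr S.
by rewrite urec //; field; rewrite um um1.
Qed.

(** The morphism [f] lets the same statement serve evaluation at real points
    (with the identity) and at complex ones. *)
Lemma krawtchouk_neq0 (F : numFieldType) (L : fieldType)
    (f : {rmorphism F -> L}) (p a : F) (z : L) (S : nat -> L -> Prop) N :
  p != 0 -> (forall m, ~ S m 0) -> S 0%N ((z - f (p * a)) / f p) ->
  (forall m r, (m < N)%N -> S m r -> S m.+1
     ((z - f (p * (a - m.+1%:R) + m.+1%:R * (1 - p))) / f p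
      - f (m.+1%:R * (1 - p) * (a - m%:R) / p) / r)) ->
  (map_poly f (krawtchouk N.+1 p a)).[z] != 0.
Proof.
move=> p0 S0 Sinit Sstep.
have fp0 : f p != 0 by rewrite fmorph_eq0.
pose u m := (map_poly f (krawtchouk m p a)).[z].
apply: (@ratio_invariant_neq0 _ u _ _ S N S0 _ _ _ Sstep) => //.
- by rewrite /u krawtchouk0 rmorph1 hornerC.
- move: Sinit; congr S; apply: (mulfI fp0); rewrite mulrC divfK //.
  rewrite /u -hornerZ -map_polyZ krawtchouk1 //.
  by rewrite rmorphB /= map_polyX map_polyC !hornerE.
- move=> m _; apply: (mulfI fp0).
  rewrite {1}/u -hornerZ -map_polyZ krawtchouk_rec //.
  rewrite rmorphB rmorphM rmorphB /= map_polyX map_polyC map_polyZ !hornerE.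
  rewrite -/(u _) -/(u _) fmorph_div /=; by field.
Qed.

(** Positivity of these coefficients makes the map from one ratio to the next
    increasing on half-lines and stable on half-planes, which is how the three
    invariants below propagate. *)
Lemma rec_coef_gt0 (R : realFieldType) (a p : R) n m :
  n%:R < a -> 0 < p < 1 -> (m <= n)%N ->
  0 < m.+1%:R * (1 - p) * (a - m%:R) / p.
Proof.
move=> an /andP[p0 p1] mn; rewrite divr_gt0 // !mulr_gt0 ?ltr0n ?subr_gt0 //.
by apply: le_lt_trans an; rewrite ler_nat.
Qed.

(** For [x <= 0] the ratio [r_m] of consecutive values is bounded above by its
    value at [0], which is [m - a < 0]: the recurrence is increasing in both [x]
    and [r_m] as long as [r_m] stays negative. *)
Lemma krawtchouk_neq0_left (R : realFieldType) (a p : R) n (x : R) :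
  n%:R < a -> 0 < p < 1 -> x <= 0 -> (krawtchouk n.+1 p a).[x] != 0.
Proof.
move=> an p01 x0; have /andP[p0 p1] := p01; have pn0 := lt0r_neq0 p0.
have ltna m : (m <= n)%N -> m%:R < a.
  by move=> mn; apply: le_lt_trans an; rewrite ler_nat.
rewrite -[krawtchouk _ _ _](@map_poly_id _ idfun _ (fun _ _ => erefl)).
(* Only for m <= n does the bound keep the ratio away from 0. *)
pose S m r := (m <= n)%N /\ r <= m%:R - a.
apply: (@krawtchouk_neq0 _ _ idfun p a x S) => //=.
- by move=> m [mn]; apply/negP; rewrite -ltNge subr_lt0 ltna.
- by split=> //; rewrite ler_pdivrMr //; nra.
move=> m r mn [_ rm]; split=> //.
have am : m%:R - a < 0 by rewrite subr_lt0 ltna // ltnW.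
have r0 : r < 0 by apply: le_lt_trans am.
have /(ler_wpM2l (ltW (rec_coef_gt0 an p01 (ltnW mn)))) :
  r^-1 >= (m%:R - a)^-1.
  by rewrite lef_nV2.
have : (x - (p * (a - m.+1%:R) + m.+1%:R * (1 - p))) / p <=
  (- (p * (a - m.+1%:R) + m.+1%:R * (1 - p))) / p.
  by rewrite ler_pM2r ?invr_gt0 //; lra.
(* The recurrence at x = 0 is satisfied exactly by the bounds m - a. *)
have -> : - (p * (a - m.+1%:R) + m.+1%:R * (1 - p)) / p = m.+1%:R - a
  + m.+1%:R * (1 - p) * (a - m%:R) / p * (m%:R - a)^-1.
  by field; rewrite pn0 ltr0_neq0.
by lra.
Qed.

(** For [a <= x] the ratio [r_m] is bounded below by its value at [a], which is
    [(a - m) (1 - p) / p > 0], by the same monotonicity on the positive side. *)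
Lemma krawtchouk_neq0_right (R : realFieldType) (a p : R) n (x : R) :
  n%:R < a -> 0 < p < 1 -> a <= x -> (krawtchouk n.+1 p a).[x] != 0.
Proof.
move=> an p01 x0; have /andP[p0 p1] := p01; have pn0 := lt0r_neq0 p0.
have ltna m : (m <= n)%N -> m%:R < a.
  by move=> mn; apply: le_lt_trans an; rewrite ler_nat.
rewrite -[krawtchouk _ _ _](@map_poly_id _ idfun _ (fun _ _ => erefl)).
pose S m r := (m <= n)%N /\ (a - m%:R) * (1 - p) / p <= r.
have bnd m : (m <= n)%N -> 0 < (a - m%:R) * (1 - p) / p.
  by move=> mn; rewrite divr_gt0 // mulr_gt0 ?subr_gt0 // ltna.
apply: (@krawtchouk_neq0 _ _ idfun p a x S) => //=.
- by move=> m [mn]; apply/negP; rewrite -ltNge bnd.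
- by split=> //; rewrite ler_pM2r ?invr_gt0 //; nra.
move=> m r mn [_ rm]; split=> //.
have am := bnd m (ltnW mn).
have r0 : 0 < r by apply: lt_le_trans rm.
have /(ler_wpM2l (ltW (rec_coef_gt0 an p01 (ltnW mn)))) :
  r^-1 <= ((a - m%:R) * (1 - p) / p)^-1.
  by rewrite lef_pV2.
have : (a - (p * (a - m.+1%:R) + m.+1%:R * (1 - p))) / p <=
   (x - (p * (a - m.+1%:R) + m.+1%:R * (1 - p))) / p.
  by rewrite ler_pM2r ?invr_gt0 //; lra.
(* The recurrence at x = a is satisfied exactly by the bounds. *)
have -> : (a - (p * (a - m.+1%:R) + m.+1%:R * (1 - p))) / p =
  (a - m.+1%:R) * (1 - p) / p
  + m.+1%:R * (1 - p) * (a - m%:R) / p * ((a - m%:R) * (1 - p) / p)^-1.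
  have := ltna _ (ltnW mn) => ?; field.
  by rewrite pn0 /= !lt0r_neq0 ?subr_gt0.
by lra.
Qed.

(** Off the real axis, [Im r_m] keeps the sign of [Im z]: for [c > 0] the map
    [r |-> - c / r] preserves that sign, and [(z - b) / p] has it already. *)
Lemma krawtchouk_neq0_nonreal (R : rcfType) (a p : R) n (z : R[i]) :
  n%:R < a -> 0 < p < 1 -> complex.Im z != 0 ->
  (map_poly (real_complex R) (krawtchouk n.+1 p a)).[z] != 0.
Proof.
move=> an p01 z0; have /andP[p0 _] := p01; have pn0 := lt0r_neq0 p0.
pose f : {rmorphism R -> R[i]} := real_complex R; rewrite -/f.
pose S (m : nat) r := 0 < complex.Im z * complex.Im r.
have Im_affine (b c : R) : complex.Im ((z - f b) / f c) = complex.Im z / c.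
  by rewrite -fmorphV; case: (z) => x y /=; rewrite oppr0 addr0 mulr0 add0r.
have Im_div (c : R) (r : R[i]) :
    complex.Im (f c / r)
    = - c * complex.Im r / (complex.Re r ^+ 2 + complex.Im r ^+ 2).
  by case: r => u v /=; rewrite mul0r addr0 mulrN mulrA !mulNr.
have ImB (u v : R[i]) : complex.Im (u - v) = complex.Im u - complex.Im v.
  by case: u; case: v.
have z2 : 0 < complex.Im z * complex.Im z by rewrite -expr2 exprn_even_gt0.
apply: (@krawtchouk_neq0 _ _ f p a z S) => //=.
- by move=> m; rewrite /S mulr0 ltxx.
- by rewrite /S Im_affine mulrA divr_gt0.
move=> m r mn Sr; have d0 := rec_coef_gt0 an p01 (ltnW mn).
have r0 : complex.Im r != 0.
  by apply: contraTneq Sr => r0; rewrite /S r0 mulr0 ltxx.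
have nr : 0 < complex.Re r ^+ 2 + complex.Im r ^+ 2.
  by rewrite ltr_wpDl ?sqr_ge0 // exprn_even_gt0.
rewrite /S ImB Im_affine Im_div mulrBr.
rewrite !mulNr mulrN opprK addr_gt0 // mulrA ?divr_gt0 //.
by rewrite mulrCA mulr_gt0.
Qed.

(** * Location of the zeros *)

Theorem theorem2 (R : realType) (n : nat) (a p : R)
    (hn : (1 <= n)%N) (ha : n%:R - 1 < a) (hp : 0 < p < 1) (z : R[i]) :
  root (map_poly (real_complex R) (krawtchouk n p a)) z ->
  exists x : R, z = x%:C /\ 0 < x < a.
Proof.
case: n hn ha => // n _; rewrite -natr1 addrK => an Kz0.
have [z0|z0] := eqVneq (complex.Im z) 0; last first.
  by case/negP: (krawtchouk_neq0_nonreal an hp z0).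
have zE : z = (complex.Re z)%:C by case: (z) z0 => x y /= ->.
exists (complex.Re z); split=> //.
move: Kz0; rewrite zE fmorph_root => Kx0; rewrite -zE.
rewrite !ltNge; apply/andP; split; apply/negP => bad.
  by case/negP: (krawtchouk_neq0_left an hp bad).
by case/negP: (krawtchouk_neq0_right an hp bad).
Qed.
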